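(* Let $R$ be a ring, $M$ an $R$-module and $C:=(0:M)$ its annihilator in $R$. Then $M$ has only finitely many $R$-submodules if and only if the following two conditions hold: (1) $M$ is finitely generated, and $M_P$ is a cyclic $R_P$-module for every $P\in\mathrm V(C)$ such that $R/P$ is infinite; (2) $R/C$ has only finitely many ideals. Moreover, if (1) and (2) both hold, write $\{P_1,\ldots,P_n\}=\mathrm V(C)$ and suppose that $R/P_i$ is infinite for each $i$. Then $M$ is generated by some elements $e_1,\ldots,e_n\in M$ such that $M_{P_i}=R_{P_i}(e_i/1)$ for each $i$.
   Context: All rings considered are commutative and unital, and $R$ is nonzero. $\mathrm V(C)=\{P\in\mathrm{Spec}(R)\mid C\subseteq P\}$. *)

(* Defs.v *)
From HB Require Import structures.
From mathcomp Require Import all_boot all_order all_algebra.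
From mathcomp Require Import all_classical.
From mathcomp Require Import ring.

Set Implicit Arguments.
Unset Strict Implicit.
Unset Printing Implicit Defensive.

Import GRing.Theory.
Local Open Scope ring_scope.
Local Open Scope quotient_scope.

Definition infinite_type (T : Type) : Prop := infinite_set [set: T]%classic.

(* Subsets are boolean predicates throughout: by the classical axioms of boolp
   every subset has one, and two of them are equal once they have the same
   elements. *)
Definition finitely_many_submodules (A : pzRingType) (V : lmodType A) : Prop :=
  finite_set [set S : V -> bool | submod_closed S]%classic.

(* The library's [idealr] only covers proper ideals; all ideals are obtained as
   the submodules of A over itself. *)
Definition finitely_many_ideals (A : comPzRingType) : Prop :=
  finitely_many_submodules A^o.

Lemma prime_idealr_inj (A : nzRingType) (P P' : prime_idealr A) :
  (P : {pred A}) =i (P' : {pred A}) -> P = P'.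
Proof.
case: P => S [[i1] [i2] [i3] [i4]]; case: P' => S' [[j1] [j2] [j3] [j4]] /=.
move=> eqSS'; have {eqSS'} eqS : S = S' by apply/funext => x; exact: eqSS'.
case: _ / eqS j1 j2 j3 j4 => j1 j2 j3 j4.
by rewrite (Prop_irrelevance i1 j1) (Prop_irrelevance i2 j2)
  (Prop_irrelevance i3 j3) (Prop_irrelevance i4 j4).
Qed.

Definition generates (A : pzRingType) (V : lmodType A) (n : nat)
    (e : 'I_n -> V) : Prop :=
  forall x : V, exists c : 'I_n -> A, x = \sum_(i < n) c i *: e i.

Definition finitely_generated (A : pzRingType) (V : lmodType A) : Prop :=
  exists n (e : 'I_n -> V), generates e.

Definition cyclic_generator (A : pzRingType) (V : lmodType A) (x : V) : Prop :=
  forall y : V, exists a : A, y = a *: x.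

Definition cyclic_module (A : pzRingType) (V : lmodType A) : Prop :=
  exists x : V, cyclic_generator x.

(* V(C) = {P_i | i < n}, without repetition. *)
Definition enumerates_primes_over (R : comNzRingType) (C : {pred R})
    (n : nat) (P : 'I_n -> prime_idealr R) : Prop :=
  injective P /\
  forall Q : prime_idealr R,
    {subset C <= (Q : {pred R})} <-> exists i, P i = Q.

Section Annihilator.
Variables (R : comNzRingType) (M : lmodType R).

Definition annihilator : {pred R} := fun a => `[< forall x : M, a *: x = 0 >].

Lemma annihilatorP a : reflect (forall x : M, a *: x = 0) (a \in annihilator).
Proof. exact: asboolP. Qed.

Fact annihilator_zmod_closed : zmod_closed annihilator.
Proof.
split=> [|a b /annihilatorP aM /annihilatorP bM]; apply/annihilatorP => x.
  by rewrite scale0r.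
by rewrite scalerBl aM bM subr0.
Qed.

HB.instance Definition _ :=
  GRing.isZmodClosed.Build R annihilator annihilator_zmod_closed.

Lemma annihilatorMl a b : b \in annihilator -> a * b \in annihilator.
Proof.
by move=> /annihilatorP bM; apply/annihilatorP => x; rewrite -scalerA bM scaler0.
Qed.

(* The library only makes quotients by proper ideals into rings, whereas the
   annihilator of the zero module is the unit ideal; hence the ring structure
   (possibly with 1 = 0) put here on the library's additive quotient. *)
Definition ann_quot : Type := Quotient.quot annihilator.

HB.instance Definition _ := GRing.Zmodule.on ann_quot.

Definition ann_proj (a : R) : ann_quot := \pi_(Quotient.quot annihilator) a.

Lemma ann_projP a b : ann_proj a = ann_proj b <-> a - b \in annihilator.
Proof.
by split=> [/eqP|h]; [|apply/eqP]; rewrite /ann_proj -Quotient.idealrBE.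
Qed.

Lemma ann_proj_surj (q : ann_quot) : exists a, q = ann_proj a.
Proof.
exists (repr (q : Quotient.quot annihilator)).
by rewrite /ann_proj reprK.
Qed.

Lemma ann_projD a b : ann_proj (a + b) = ann_proj a + ann_proj b.
Proof. exact: Quotient.pi_add. Qed.

Definition ann_mul (p q : ann_quot) : ann_quot :=
  ann_proj (repr (p : Quotient.quot annihilator)
            * repr (q : Quotient.quot annihilator)).

Lemma ann_projM a b : ann_proj (a * b) = ann_mul (ann_proj a) (ann_proj b).
Proof.
rewrite /ann_mul; set a' := repr _; set b' := repr _.
have/ann_projP ha : ann_proj a = ann_proj a' by rewrite /ann_proj reprK.
have/ann_projP hb : ann_proj b = ann_proj b' by rewrite /ann_proj reprK.
apply/ann_projP.
have -> : a * b - a' * b' = b * (a - a') + a' * (b - b').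
  by rewrite !mulrBr [b * a]mulrC [b * a']mulrC addrA subrK.
by rewrite rpredD // annihilatorMl.
Qed.

Fact ann_mulA : associative ann_mul.
Proof.
move=> x y z; case: (ann_proj_surj x) (ann_proj_surj y) (ann_proj_surj z).
by move=> a -> [b ->] [c ->]; rewrite -!ann_projM mulrA.
Qed.

Fact ann_mulC : commutative ann_mul.
Proof. by move=> x y; rewrite /ann_mul mulrC. Qed.

Fact ann_mul1 : left_id (ann_proj 1) ann_mul.
Proof.
by move=> x; case: (ann_proj_surj x) => a ->; rewrite -ann_projM mul1r.
Qed.

Fact ann_mulDl : left_distributive ann_mul +%R.
Proof.
move=> x y z; case: (ann_proj_surj x) (ann_proj_surj y) (ann_proj_surj z).
move=> a -> [b ->] [c ->].
by rewrite -ann_projD -!ann_projM mulrDl ann_projD.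
Qed.

HB.instance Definition _ := GRing.Zmodule_isComPzRing.Build ann_quot
  ann_mulA ann_mulC ann_mul1 ann_mulDl.

End Annihilator.

(* Localization at a prime ideal P: the module M_P of fractions x/s with x in M
   and s outside P, where x/s = y/t iff u(tx - sy) = 0 for some u outside P; the
   ring R_P is the case M = R. *)
Section Localization.
Variables (R : comNzRingType) (P : prime_idealr R).

Definition denom : Type := {s : R | s \notin (P : {pred R})}.
HB.instance Definition _ := Choice.on denom.

Definition mkdenom (s : R) (sP : s \notin (P : {pred R})) : denom :=
  exist (fun s => s \notin (P : {pred R})) s sP.

Definition denom1 : denom := mkdenom (negbT (idealr1 P)).

Definition dval (s : denom) : R := val s.
Arguments dval : simpl never.

Fact denomM_subproof (s t : denom) : dval s * dval t \notin (P : {pred R}).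
Proof. by rewrite prime_idealrM negb_or (valP s) (valP t). Qed.

Definition denomM (s t : denom) : denom := mkdenom (denomM_subproof s t).

Lemma dval_inj : injective dval. Proof. exact: val_inj. Qed.

Lemma denom1E : dval denom1 = 1. Proof. by []. Qed.
Lemma denomME s t : dval (denomM s t) = dval s * dval t. Proof. by []. Qed.

Section Module.
Variable M : lmodType R.

Definition loc_equiv (p q : M * denom) : bool :=
  `[< exists u : denom,
        dval u *: (dval q.2 *: p.1 - dval p.2 *: q.1) = 0 >].

Lemma loc_equivP (p q : M * denom) :
  reflect (exists u : denom,
             dval u *: (dval q.2 *: p.1) = dval u *: (dval p.2 *: q.1))
          (loc_equiv p q).
Proof.
apply: (iffP (asboolP _)) => -[u h]; exists u; last by rewrite scalerBr h subrr.
by apply/eqP; rewrite -subr_eq0 -scalerBr h.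
Qed.

Fact loc_equiv_refl : reflexive loc_equiv.
Proof. by move=> p; apply/loc_equivP; exists denom1. Qed.

Fact loc_equiv_sym : symmetric loc_equiv.
Proof. by move=> p q; apply/loc_equivP/loc_equivP => -[u h]; exists u. Qed.

Fact loc_equiv_trans : transitive loc_equiv.
Proof.
move=> [y t] [x s] [z w] /loc_equivP[u /= hu] /loc_equivP[v /= hv].
apply/loc_equivP; exists (denomM (denomM u v) t); rewrite ?denomME ?denom1E /=.
rewrite !scalerA in hu hv *.
transitivity ((dval v * dval w) *: ((dval u * dval t) *: x)).
  by rewrite scalerA; congr (_ *: _); ring.
transitivity ((dval u * dval s) *: ((dval v * dval w) *: y)).
  by rewrite hu !scalerA; congr (_ *: _); ring.
by rewrite hv scalerA; congr (_ *: _); ring.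
Qed.

Canonical loc_equiv_equiv :=
  EquivRel loc_equiv loc_equiv_refl loc_equiv_sym loc_equiv_trans.

Definition localization : Type := {eq_quot loc_equiv}.

HB.instance Definition _ := Choice.on localization.

Definition locfrac (x : M) (s : denom) : localization :=
  \pi_{eq_quot loc_equiv} (x, s).

Lemma locfracP x s y t : locfrac x s = locfrac y t <->
  exists u : denom, dval u *: (dval t *: x) = dval u *: (dval s *: y).
Proof.
split=> [/eqmodP/loc_equivP //|h].
by apply/eqmodP/loc_equivP.
Qed.

Lemma locfrac_surj (q : localization) : exists x s, q = locfrac x s.
Proof.
exists (repr (q : {eq_quot loc_equiv})).1, (repr (q : {eq_quot loc_equiv})).2.
by rewrite /locfrac -surjective_pairing reprK.
Qed.

Definition locnum (q : localization) : M := (repr (q : {eq_quot loc_equiv})).1.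
Definition locden (q : localization) : denom :=
  (repr (q : {eq_quot loc_equiv})).2.

Lemma locnumdenK q : locfrac (locnum q) (locden q) = q.
Proof. by rewrite /locfrac -surjective_pairing reprK. Qed.

Definition loc_add (p q : localization) : localization :=
  locfrac (dval (locden q) *: locnum p + dval (locden p) *: locnum q)
          (denomM (locden p) (locden q)).

Definition loc_opp (p : localization) : localization :=
  locfrac (- locnum p) (locden p).

Lemma loc_addE x s y t : loc_add (locfrac x s) (locfrac y t) =
  locfrac (dval t *: x + dval s *: y) (denomM s t).
Proof.
rewrite /loc_add; have := locnumdenK (locfrac x s).
have := locnumdenK (locfrac y t).
set y' := locnum _; set t' := locden _; set x' := locnum _; set s' := locden _.
move=> /locfracP[v hv] /locfracP[u hu]; apply/locfracP.
exists (denomM u v); rewrite ?denomME ?denom1E /=; rewrite !scalerDr !scalerA in hv hu *.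
congr (_ + _).
  transitivity ((dval v * dval t * dval t') *: ((dval u * dval s) *: x')).
    by rewrite scalerA; congr (_ *: _); ring.
  rewrite hu scalerA; congr (_ *: _).
  by ring.
transitivity ((dval u * dval s * dval s') *: ((dval v * dval t) *: y')).
  by rewrite scalerA; congr (_ *: _); ring.
rewrite hv scalerA; congr (_ *: _).
by ring.
Qed.

Lemma loc_oppE x s : loc_opp (locfrac x s) = locfrac (- x) s.
Proof.
rewrite /loc_opp; have := locnumdenK (locfrac x s).
move=> /locfracP[u hu]; apply/locfracP.
by exists u; rewrite !scalerN hu.
Qed.

Fact loc_addA : associative loc_add.
Proof.
move=> a b c; have [x [s ->]] := locfrac_surj a.
have [y [t ->]] := locfrac_surj b; have [z [w ->]] := locfrac_surj c.
rewrite !loc_addE /=; congr locfrac; last by apply/dval_inj; rewrite !(denomME, denom1E) mulrA.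
by rewrite !scalerDr !scalerA addrA [dval w * dval t]mulrC [dval w * dval s]mulrC.
Qed.

Fact loc_addC : commutative loc_add.
Proof.
move=> a b; have [x [s ->]] := locfrac_surj a.
have [y [t ->]] := locfrac_surj b; rewrite !loc_addE addrC; congr locfrac.
by apply/dval_inj; rewrite !(denomME, denom1E) mulrC.
Qed.

Fact loc_add0 : left_id (locfrac 0 denom1) loc_add.
Proof.
move=> a; have [x [s ->]] := locfrac_surj a.
rewrite loc_addE scaler0 add0r scale1r; congr locfrac.
by apply/dval_inj; rewrite !(denomME, denom1E) mul1r.
Qed.

Fact loc_addN : left_inverse (locfrac 0 denom1) loc_opp loc_add.
Proof.
move=> a; have [x [s ->]] := locfrac_surj a.
rewrite loc_oppE loc_addE scalerN addNr.
by apply/locfracP; exists denom1; rewrite !scaler0.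
Qed.

HB.instance Definition _ := GRing.isZmodule.Build localization
  loc_addA loc_addC loc_add0 loc_addN.

Lemma locfracD x s y t : locfrac x s + locfrac y t =
  locfrac (dval t *: x + dval s *: y) (denomM s t).
Proof. exact: loc_addE. Qed.

End Module.

Definition loc_ring : Type := localization R^o.

HB.instance Definition _ := GRing.Zmodule.on loc_ring.

Definition ringfrac (a : R) (s : denom) : loc_ring := locfrac (a : R^o) s.

Lemma ringfrac_surj (q : loc_ring) : exists a s, q = ringfrac a s.
Proof. exact: (@locfrac_surj R^o q). Qed.

Section Scaling.
Variable M : lmodType R.

Definition loc_scale (a : loc_ring) (q : localization M) : localization M :=
  locfrac ((locnum a : R) *: locnum q) (denomM (locden a) (locden q)).

Lemma loc_scaleE a s (x : M) t :
  loc_scale (ringfrac a s) (locfrac x t) = locfrac (a *: x) (denomM s t).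
Proof.
rewrite /loc_scale /ringfrac; have := locnumdenK (locfrac (a : R^o) s).
have := locnumdenK (locfrac x t).
set x' := locnum _; set t' := locden _; set a' := locnum _; set s' := locden _.
move=> /locfracP[v hv] /locfracP[u hu]; apply/locfracP.
have {}hu : dval u * (dval s * a') = dval u * (dval s' * a) := hu.
exists (denomM u v); rewrite ?denomME ?denom1E /=; rewrite !scalerA in hv *.
transitivity ((dval u * (dval s * a')) *: ((dval v * dval t) *: x')).
  by rewrite scalerA; congr (_ *: _); ring.
rewrite hu hv scalerA; congr (_ *: _).
by ring.
Qed.

Fact loc_scaleDr a : {morph loc_scale a : p q / p + q}.
Proof.
move=> p q; have [r [s ->]] := ringfrac_surj a.
have [x [t ->]] := locfrac_surj p; have [y [w ->]] := locfrac_surj q.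
rewrite locfracD !loc_scaleE locfracD; apply/locfracP; exists denom1 ; rewrite ?denomME ?denom1E /=.
rewrite !scale1r !scalerDr !scalerA; congr (_ *: _ + _ *: _); ring.
Qed.

Fact loc_scaleDl q : {morph loc_scale^~ q : a b / a + b}.
Proof.
move=> a b; have [r [s ->]] := ringfrac_surj a.
have [r' [s' ->]] := ringfrac_surj b; have [x [t ->]] := locfrac_surj q.
have -> : ringfrac r s + ringfrac r' s' =
  ringfrac (dval s' * r + dval s * r') (denomM s s') by exact: locfracD.
rewrite !loc_scaleE locfracD; apply/locfracP; exists denom1 ; rewrite ?denomME ?denom1E /=.
rewrite !scale1r !scalerA -!scalerDl !scalerA; congr (_ *: _); ring.
Qed.

Fact loc_scale1 : left_id (ringfrac 1 denom1) loc_scale.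
Proof.
move=> q; have [x [t ->]] := locfrac_surj q; rewrite loc_scaleE scale1r.
by congr locfrac; apply/dval_inj; rewrite !(denomME, denom1E) mul1r.
Qed.

End Scaling.

Definition loc_mul (a b : loc_ring) : loc_ring := @loc_scale R^o a b.

Lemma loc_mulE a s b t :
  loc_mul (ringfrac a s) (ringfrac b t) = ringfrac (a * b) (denomM s t).
Proof. exact: loc_scaleE. Qed.

Fact loc_scaleA (M : lmodType R) a b (q : localization M) :
  loc_scale a (loc_scale b q) = loc_scale (loc_mul a b) q.
Proof.
have [r [s ->]] := ringfrac_surj a; have [r' [s' ->]] := ringfrac_surj b.
have [x [t ->]] := locfrac_surj q; rewrite loc_mulE !loc_scaleE scalerA.
by congr locfrac; apply/dval_inj; rewrite !(denomME, denom1E) mulrA.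
Qed.

Fact loc_mulA : associative loc_mul.
Proof. by move=> a b c; exact: (@loc_scaleA R^o). Qed.

Fact loc_mulC : commutative loc_mul.
Proof.
move=> a b; have [r [s ->]] := ringfrac_surj a.
have [r' [s' ->]] := ringfrac_surj b; rewrite !loc_mulE mulrC.
by congr locfrac; apply/dval_inj; rewrite !(denomME, denom1E) mulrC.
Qed.

Fact loc_mul1 : left_id (ringfrac 1 denom1) loc_mul.
Proof. exact: (@loc_scale1 R^o). Qed.

Fact loc_mulDl : left_distributive loc_mul +%R.
Proof. by move=> a b c; exact: (@loc_scaleDl R^o c a b). Qed.

Fact loc_oner_neq0 : ringfrac 1 denom1 != 0.
Proof.
apply/eqP => /locfracP[u] h.
have {h} : dval u * (1 * 1) = dval u * (1 * 0) := h.
rewrite !mulr1 !mulr0 => u0; have := valP u; rewrite -[\val u]/(dval u) u0.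
by rewrite idealr0.
Qed.

HB.instance Definition _ := GRing.Zmodule_isComNzRing.Build loc_ring
  loc_mulA loc_mulC loc_mul1 loc_mulDl loc_oner_neq0.

HB.instance Definition _ (M : lmodType R) :=
  GRing.Zmodule_isLmodule.Build loc_ring (localization M)
    (@loc_scaleA M) (@loc_scale1 M) (@loc_scaleDr M) (@loc_scaleDl M).

Lemma ringfracD a s b t : ringfrac a s + ringfrac b t =
  ringfrac (dval t * a + dval s * b) (denomM s t).
Proof. exact: locfracD. Qed.

Lemma ringfracM a s b t :
  ringfrac a s * ringfrac b t = ringfrac (a * b) (denomM s t).
Proof. exact: loc_mulE. Qed.

Lemma locfracZ (M : lmodType R) a s (x : M) t :
  ringfrac a s *: locfrac x t = locfrac (a *: x) (denomM s t).
Proof. exact: loc_scaleE. Qed.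

(* x |-> x/1 *)
Definition loc_map (M : lmodType R) (x : M) : localization M :=
  locfrac x denom1.

End Localization.

(* Main.v *)
Require Import Defs.
From HB Require Import structures.
From mathcomp Require Import all_boot all_order all_algebra.
From mathcomp Require Import all_classical.
From mathcomp Require Import ring.

Set Implicit Arguments.
Unset Strict Implicit.
Unset Printing Implicit Defensive.

Import GRing.Theory.
Local Open Scope ring_scope.

(** For a prime P and a submodule N of M, the saturation of N at P is the set
    of the x with s x in N for some s outside P, that is, the preimage in M of
    N_P.  A submodule that contains C M is the intersection of its saturations
    at the primes containing C ([local_global]).  Hence, once V(C) is finite,
    finiteness of a family of submodules can be tested one prime at a time
    ([finite_submods_local]), and this applies both to the submodules of M and
    to the ideals of R containing C := (0 : M), which are the ideals of R/C.

    At a prime P with R/P finite, both families become finite for the same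
    reason.  If only finitely many submodules contain B, then M modulo the
    saturation of B is finite ([finite_index_saturation]): going down from the
    top, each step of a chain of saturated submodules adds a copy of R/P.  When
    M is finitely generated, R is finite modulo the saturation of C if and only
    if M is finite modulo the saturation of 0 ([finite_index_annihilator]),
    which lets finiteness pass between R/C and M.

    At a prime P with R/P infinite, M_P is cyclic: this is assumed in one
    direction.  In the other direction, if M has finitely many submodules, two
    of the infinitely many elements z + a y with distinct residues a mod P
    generate the same submodule Rw; then w generates z and y locally, so a z
    with R z locally as large as possible generates M locally
    ([locally_cyclic_of_finite]).  With z a local generator, a saturated
    submodule N is determined by the ideal of the a with a z in N, and the
    saturation of an ideal I containing C is determined by the submodule I z;
    so again finiteness passes between ideals and submodules.

    V(C) is finite if R/C has finitely many ideals; if instead M has finitely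
    many submodules and generators e_i, then a prime Q above C is determined by
    the submodules Q e_i ([finite_primes_of_finite]).

    For the last assertion, choose for each P_i in V(C) an element e_i that
    generates M at P_i.  The submodule generated by all e_i has saturation M at
    each prime of V(C), hence is M. *)

(** * Finite sets *)

(** A labelling, injective on A, by a finite type is the form in which
    finiteness is established and used below: labels combine in products and
    finite functions, and no cardinal needs to be computed. *)
Lemma finite_labelP (U : Type) (A : set U) :
  finite_set A <-> exists (T : finType) (l : U -> T),
    forall x y, A x -> A y -> l x = l y -> x = y.
Proof.
split=> [/finite_set_leP[n /pcard_leP/injfunPex[f fA finj]]|[T [l linj]]].
  exists 'I_n.+1, (fun x => inord (f x)) => x y Ax Ay eqf.
  apply: finj; rewrite ?in_setE //.
  have lt z : A z -> (f z < n.+1)%N by move=> /fA /= /ltnW.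
  by have := congr1 val eqf; rewrite /= !inordK ?lt.
apply/finite_set_leP; exists #|T|; apply/pcard_leP/injfunPex.
exists (fun x => enum_rank (l x) : nat) => [x _ /=|x y]; first exact: ltn_ord.
rewrite !in_setE => Ax Ay /val_inj/enum_rank_inj; exact: linj.
Qed.

Lemma finite_set_family (I : finType) (U V : Type) (A : set U)
    (F : I -> U -> V) :
    (forall i, finite_set [set F i x | x in A]%classic) ->
    (forall x y, A x -> A y -> (forall i, F i x = F i y) -> x = y) ->
  finite_set A.
Proof.
move=> finF Finj.
have /choice[L LP] (i : I) : exists L : {T : finType & V -> T},
    forall x y, A x -> A y -> projT2 L (F i x) = projT2 L (F i y) ->
      F i x = F i y.
  have /finite_labelP[T [l linj]] := finF i.
  exists (existT _ T l) => x y Ax Ay; apply: linj; first by exists x.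
  by exists y.
apply/finite_labelP.
exists {dffun forall i, projT1 (L i)},
  (fun x => [ffun i => projT2 (L i) (F i x)]) => x y Ax Ay eql.
apply: Finj => // i; apply: LP => //.
by have := congr1 (fun f : {dffun _} => f i) eql; rewrite !ffunE.
Qed.

Lemma finite_set_enum (U : Type) (A : set U) : finite_set A ->
  exists n (f : 'I_n -> U), injective f /\ forall x, A x <-> exists i, f i = x.
Proof.
move=> /finite_labelP[T [l linj]].
pose D : {set T} := [set t | `[< exists2 x, A x & l x = t >]].
have /choice[f fP] (i : 'I_#|D|) : exists x, A x /\ l x = enum_val i.
  by have := enum_valP i; rewrite inE => /asboolP[x Ax lx]; exists x.
exists #|D|, f; split=> [i j eqf|x].
  by apply: enum_val_inj; rewrite -(fP i).2 -(fP j).2 eqf.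
split=> [Ax|[i <-]]; last exact: (fP i).1.
have lxD : l x \in D by rewrite inE; apply/asboolP; exists x.
exists (enum_rank_in lxD (l x)); apply: linj => //; first exact: (fP _).1.
by rewrite (fP _).2 enum_rankK_in.
Qed.

(** Take m with the fewest labels of elements of A above it: if x is strictly
    above m, then m is lost and nothing is gained in passing from m to x. *)
Lemma finite_set_maximal (U : Type) (r : U -> U -> Prop) (A : set U) :
    (forall x, r x x) -> (forall x y z, r x y -> r y z -> r x z) ->
    finite_set A -> (exists x, A x) ->
  exists2 m, A m & forall x, A x -> r m x -> r x m.
Proof.
move=> rxx rtr /finite_labelP[T [l linj]] [x0 Ax0].
pose up x : {set T} := [set t | `[< exists y, [/\ A y, r x y & l y = t] >]].
have /ex_minnP[k /asboolP[m [Am <-]] kmin] :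
    exists k, `[< exists x, A x /\ #|up x| = k >].
  by exists #|up x0|; apply/asboolP; exists x0.
exists m => // x Ax rmx; apply: contrapT => nrxm.
have /kmin : `[< exists y, A y /\ #|up y| = #|up x| >].
  by apply/asboolP; exists x.
apply/negP; rewrite -ltnNge; apply: proper_card; apply/properP; split.
  apply/fintype.subsetP=> t; rewrite !inE => -[y [Ay rxy lyt]].
  by exists y; split=> //; apply: rtr rxy.
exists (l m); rewrite inE; first by apply/asboolP; exists m.
by apply/asboolP => -[y [Ay rxy /linj eqym]]; apply: nrxm; rewrite -eqym.
Qed.

(** * Submodules *)

Section Submodules.
Variables (R : comNzRingType) (M : lmodType R).
Implicit Types S N B : {pred M}.

Lemma submod0 S : submod_closed S -> 0 \in S.
Proof. by case. Qed.

Lemma submodD S x y : submod_closed S -> x \in S -> y \in S -> x + y \in S.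
Proof. by case=> _ SL Sx Sy; rewrite -[x]scale1r SL. Qed.

Lemma submodZ S a x : submod_closed S -> x \in S -> a *: x \in S.
Proof. by case=> S0 SL Sx; rewrite -[_ *: x]addr0 SL. Qed.

Lemma submodB S x y : submod_closed S -> x \in S -> y \in S -> x - y \in S.
Proof. by move=> cS Sx Sy; rewrite -scaleN1r submodD ?submodZ. Qed.

Lemma submod_sum S n (F : 'I_n -> M) :
  submod_closed S -> (forall i, F i \in S) -> \sum_(i < n) F i \in S.
Proof.
move=> cS SF; elim/big_ind: _ => // [|x y]; [exact: submod0 | exact: submodD].
Qed.

Definition submods_above B : set (M -> bool) :=
  [set S : M -> bool | submod_closed S /\ {subset B <= (S : {pred M})}]%classic.

Definition zero_submod : {pred M} := pred1 0.

Lemma zero_submod_closed : submod_closed zero_submod.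
Proof.
by split=> [|a u v /eqP-> /eqP->]; rewrite unfold_in /= ?scaler0 ?addr0.
Qed.

Definition cyclic_submod (x : M) : {pred M} :=
  fun y => `[< exists a : R, y = a *: x >].

Lemma cyclic_submodP x y :
  reflect (exists a : R, y = a *: x) (y \in cyclic_submod x).
Proof. exact: asboolP. Qed.

Lemma cyclic_submod_closed x : submod_closed (cyclic_submod x).
Proof.
split=> [|a u v /cyclic_submodP[b ->] /cyclic_submodP[c ->]];
  apply/cyclic_submodP; first by exists 0; rewrite scale0r.
by exists (a * b + c); rewrite scalerDl scalerA.
Qed.

Lemma mem_cyclic x : x \in cyclic_submod x.
Proof. by apply/cyclic_submodP; exists 1; rewrite scale1r. Qed.

Lemma cyclic_sub S x : submod_closed S -> x \in S ->
  {subset cyclic_submod x <= S}.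
Proof. by move=> cS Sx y /cyclic_submodP[a ->]; apply: submodZ. Qed.

End Submodules.

Section SubmoduleConstructions.
Variables (R : comNzRingType) (M : lmodType R).
Implicit Types S N B : {pred M}.

Definition scale_ideal (I : {pred R^o}) (x : M) : {pred M} :=
  fun y => `[< exists2 a : R, a \in I & y = a *: x >].

Lemma scale_idealP (I : {pred R^o}) x y :
  reflect (exists2 a : R, a \in I & y = a *: x) (y \in scale_ideal I x).
Proof. exact: asboolP. Qed.

Lemma scale_ideal_closed (I : {pred R^o}) x : submod_closed I ->
  submod_closed (scale_ideal I x).
Proof.
move=> cI; split=> [|a u v /scale_idealP[b Ib ->] /scale_idealP[c Ic ->]];
  apply/scale_idealP.
  by exists 0; rewrite ?scale0r //; exact: (submod0 cI).
by exists (a * b + c); [case: cI => _; apply|rewrite scalerDl scalerA].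
Qed.

(** The submodule N + R x. *)
Definition submod_add N x : {pred M} :=
  fun y => `[< exists a : R, y - a *: x \in N >].

Lemma submod_addP N x y :
  reflect (exists a : R, y - a *: x \in N) (y \in submod_add N x).
Proof. exact: asboolP. Qed.

Lemma submod_add_closed N x : submod_closed N -> submod_closed (submod_add N x).
Proof.
move=> cN; split=> [|a u v /submod_addP[b Nu] /submod_addP[c Nv]];
  apply/submod_addP; first by exists 0; rewrite scale0r subr0 submod0.
exists (a * b + c); rewrite scalerDl -scalerA opprD addrACA -scalerBr.
by rewrite submodD ?submodZ.
Qed.

Lemma mem_submod_add N x : submod_closed N -> x \in submod_add N x.
Proof.
by move=> cN; apply/submod_addP; exists 1; rewrite scale1r subrr submod0.
Qed.

Lemma sub_submod_add N x : {subset N <= submod_add N x}.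
Proof. by move=> y Ny; apply/submod_addP; exists 0; rewrite scale0r subr0. Qed.

(** Finiteness of M/S, without forming the quotient: the label of an element
    determines its class. *)
Definition finite_index S : Prop :=
  exists (T : finType) (l : M -> T), forall x y, l x = l y -> x - y \in S.

(** Since M/N is an extension of M/N' by N'/N, it is finite if both are: an
    element is labelled by its class modulo N' and by the label of its
    difference with a chosen representative of this class. *)
Lemma finite_index_trans N N' (T : finType) (l : M -> T) :
    submod_closed N -> submod_closed N' -> finite_index N' ->
    (forall x y, x \in N' -> y \in N' -> l x = l y -> x - y \in N) ->
  finite_index N.
Proof.
move=> cN cN' [T' [l' l'P]] lP.
have /choice[rep repP] (t : T') : exists x, (exists y, l' y = t) -> l' x = t.
  have [[y <-]|nex] := pselect (exists y, l' y = t); first by exists y.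
  by exists 0 => /nex.
have repN' x : x - rep (l' x) \in N'.
  by apply: l'P; rewrite repP //; exists x.
exists (T' * T)%type, (fun x => (l' x, l (x - rep (l' x)))) => x y [eql'].
move=> /(lP _ _ (repN' x) (repN' y)); rewrite eql'.
by rewrite opprB addrA addrNK.
Qed.

(** Submodules containing B are unions of classes modulo B. *)
Lemma finite_submods_above_index B : finite_index B ->
  finite_set (submods_above B).
Proof.
move=> [T [l lP]]; apply/finite_labelP.
exists {set T}, (fun S => [set t | `[< exists2 x, x \in S & l x = t >]]).
have sub S S' : submods_above B S -> submods_above B S' ->
    [set t | `[< exists2 x, x \in S & l x = t >]] =
    [set t | `[< exists2 x, x \in S' & l x = t >]] -> {subset S <= S'}.
  move=> [cS BS] [cS' BS'] /setP eqSS' x Sx; move: (eqSS' (l x)).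
  rewrite !inE => eql.
  have /asboolP[y S'y /esym/lP/BS' Sxy] :
      `[< exists2 y, y \in S' & l y = l x >].
    by rewrite -eql; apply/asboolP; exists x.
  by rewrite -(subrK y x) submodD.
move=> S S' hS hS' eqSS'; apply/funext => x; apply/idP/idP.
  exact: (sub S S').
exact: (sub S' S).
Qed.

End SubmoduleConstructions.

(** * Prime ideals *)

Section Primes.
Variable R : comNzRingType.
Implicit Types (P : prime_idealr R) (C : {pred R}).

(** An ideal that is maximal among the proper ideals containing J is prime. *)
Lemma exists_prime_above (J : {pred R^o}) :
    submod_closed J -> (1 : R) \notin J ->
  exists P : prime_idealr R, {subset J <= (P : {pred R})}.
Proof.
move=> cJ J1.
(* Containment of J is required of nonempty sets only, so that the union of the
   empty chain qualifies. *)
pose good : set (set R) := [set X : set R | [/\ ~ X 1,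
  forall a x y, X x -> X y -> X (a * x + y) &
  forall x, X x -> forall y, y \in J -> X y]]%classic.
have [F Fgood Ftot|X [[X1 Xlin XJ] Xmax]] := @Zorn_bigcup R good.
  split=> [[X /Fgood[X1 _ _] /X1//]|a x y [X FX Xx] [Y FY Yy]|x [X FX Xx] y Jy].
  - have [XY|YX] := Ftot X Y FX FY.
      by exists Y => //; have [_ + _] := Fgood _ FY; apply=> //; apply: XY.
    by exists X => //; have [_ + _] := Fgood _ FX; apply=> //; apply: YX.
  - by exists X => //; have [_ _] := Fgood _ FX; apply; first exact: Xx.
have goodJ : good [set x | x \in J]%classic.
  split=> [|a x y Jx Jy|//]; first exact/negP.
  by case: cJ => _; apply.
have [x Xx] : exists x, X x.
  apply: contrapT => X0; apply: (Xmax [set x | x \in J]%classic) goodJ.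
  split=> [y Xy|J0]; first by case: X0; exists y.
  by apply: X0; exists 0; apply: J0; apply: (submod0 cJ).
have X0 : X 0 by apply: XJ (submod0 cJ); exact: Xx.
pose p : R -> bool := fun y => `[< X y >].
have p_closed : idealr_closed p.
  split=> [||a u v /asboolP Xu /asboolP Xv]; apply/asboolP => //.
  exact: Xlin.
have p_prime : prime_idealr_closed p.
  (* If u v is in X but u is not, X + R u contains 1 by maximality, whence v is
     in X. *)
  move=> u v /asboolP Xuv; apply/orP; apply: contrapT => /not_orP[pu pv].
  have Xu : ~ X u by move/asboolP.
  have Xv : ~ X v by move/asboolP.
  pose Y : set R := [set y | exists a, X (y - a * u)]%classic.
  have XY : (X `<=` Y)%classic.
    by move=> y Xy; exists 0; rewrite mul0r subr0.
  apply: (Xmax Y); first split=> // YX.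
    by apply: Xu; apply: YX; exists 1; rewrite mul1r subrr.
  split=> [[a Xa]|a y z [b Xb] [c Xc]|_ _ y Jy].
  - apply: Xv.
    have -> : v = v * (1 - a * u) + (a * (u * v) + 0) by ring.
    by apply: (Xlin) => //; apply: (Xlin).
  - exists (a * b + c).
    have -> : a * y + z - (a * b + c) * u = a * (y - b * u) + (z - c * u).
      by ring.
    exact: Xlin.
  - by apply: XY; apply: XJ Jy; exact: X0.
pose P : prime_idealr R := HB.pack p (isIdealr.Build R p p_closed)
  (isPrimeIdealrClosed.Build R p p_prime).
by exists P => y Jy; apply/asboolP; apply: XJ Jy; exact: X0.
Qed.

(** A set of predicates rather than of bundled prime ideals: the type of the
    latter lies in a universe too large for it to carry sets. *)
Definition primes_above C : set (R -> bool) :=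
  [set p : R -> bool | exists2 P : prime_idealr R,
     {subset C <= (P : {pred R})} & p = P]%classic.

Lemma primes_above_enum C : finite_set (primes_above C) ->
  exists n (P : 'I_n -> prime_idealr R), enumerates_primes_over C P.
Proof.
move=> /finite_set_enum[n [p [pinj pE]]].
have /fin_all_exists[P PP] (i : 'I_n) : exists P : prime_idealr R,
    {subset C <= (P : {pred R})} /\ p i = P.
  by have [P CP eqp] := (pE (p i)).2 (ex_intro _ i erefl); exists P.
exists n, P; split=> [i j eqP|Q].
  by apply: pinj; rewrite (PP i).2 (PP j).2 eqP.
split=> [CQ|[i <-]]; last exact: (PP i).1.
have [i eqi] := (pE Q).1 (ex_intro2 _ _ Q CQ erefl).
exists i; apply: prime_idealr_inj => a.
by rewrite -[LHS]/((P i : R -> bool) a) -(PP i).2 eqi.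
Qed.

Lemma prime_submod_closed (P : prime_idealr R) : submod_closed (P : {pred R^o}).
Proof.
split=> [|a u v Pu Pv]; first exact: idealr0.
by apply: rpredD => //; apply: idealMr.
Qed.

Lemma prime_notinM P s t : s \notin (P : {pred R}) -> t \notin (P : {pred R}) ->
  s * t \notin (P : {pred R}).
Proof. by move=> Ps Pt; rewrite prime_idealrM negb_or Ps. Qed.

Lemma finite_residueP (P : prime_idealr R) :
  finite_index (P : {pred R^o}) <-> ~ infinite_type {ideal_quot P}.
Proof.
have reprE (q q' : {ideal_quot P}) :
    repr q - repr q' \in (P : {pred R}) -> q = q'.
  by rewrite Quotient.idealrBE !reprK => /eqP.
have piE (a b : R) : (\pi_{ideal_quot P} a = \pi_{ideal_quot P} b)%qT ->
    a - b \in (P : {pred R}).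
  by move=> /eqP; rewrite -Quotient.idealrBE.
split=> [[T [l lP]]|/contrapT/finite_labelP[T [l linj]]].
  apply; apply/finite_labelP; exists T, (fun q => l (repr q)) => q q' _ _ /lP.
  exact: reprE.
exists T, (fun a : R => l (\pi_{ideal_quot P} a)%qT) => a b.
by move=> /linj eqpi; apply: piE; apply: eqpi.
Qed.

(** A finite integral domain is a field: two powers of s coincide modulo P,
    and s can be cancelled. *)
Lemma finite_residue_inv (P : prime_idealr R) (s : R) :
    finite_index (P : {pred R^o}) -> s \notin (P : {pred R}) ->
  exists t : R, t * s - 1 \in (P : {pred R}).
Proof.
move=> [T [l lP]] Ps.
have [i [j [lt_ij Pij]]] : exists i j : nat,
    (i < j)%N /\ s ^+ i - s ^+ j \in (P : {pred R}).
  apply: contrapT => nij; apply: infinite_nat; apply/finite_labelP.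
  exists T, (fun i => l (s ^+ i)) => i j _ _ eql.
  have Pij := lP _ _ eql; have Pji := lP _ _ (esym eql).
  by case: (ltngtP i j) => // lt_ij; case: nij; [exists i, j | exists j, i].
exists (s ^+ (j - i).-1); rewrite -exprSr prednK ?subn_gt0 //.
have : s ^+ i * (1 - s ^+ (j - i)) \in (P : {pred R}).
  by rewrite mulrBr mulr1 -exprD subnKC // ltnW.
have Psk k : (s ^+ k \in (P : {pred R})) = false.
  elim: k => [|k IH]; first by rewrite expr0 idealr1.
  by rewrite exprS prime_idealrM (negPf Ps).
by rewrite prime_idealrM Psk /= -rpredN opprB.
Qed.

End Primes.

(** * Saturation at a prime *)

Section Saturation.
Variables (R : comNzRingType) (M : lmodType R).
Implicit Types (P : prime_idealr R) (S N B : {pred M}) (C : {pred R}).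

(** The preimage of the localization S_P under the map from M to M_P. *)
Definition saturation P S : {pred M} :=
  fun x => `[< exists2 s : R, s \notin (P : {pred R}) & s *: x \in S >].

Lemma saturationP P S x :
  reflect (exists2 s : R, s \notin (P : {pred R}) & s *: x \in S)
          (x \in saturation P S).
Proof. exact: asboolP. Qed.

Lemma sub_saturation P S : {subset S <= saturation P S}.
Proof.
by move=> x Sx; apply/saturationP; exists 1; rewrite ?scale1r ?idealr1.
Qed.

Lemma saturation_closed P S : submod_closed S -> submod_closed (saturation P S).
Proof.
move=> cS; split=> [|a u v /saturationP[s Ps Su] /saturationP[t Pt Sv]].
  by apply: sub_saturation; exact: submod0.
apply/saturationP; exists (s * t); first exact: prime_notinM.
rewrite scalerDr -!scalerA; apply: submodD => //; last exact: submodZ.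
have -> : s *: (t *: (a *: u)) = (t * a) *: (s *: u).
  by rewrite !scalerA; congr (_ *: _); ring.
exact: submodZ.
Qed.

Lemma saturationS P S S' :
  {subset S <= S'} -> {subset saturation P S <= saturation P S'}.
Proof.
by move=> SS' x /saturationP[s Ps /SS' Sx]; apply/saturationP; exists s.
Qed.

Lemma saturation_idem P S :
  {subset saturation P (saturation P S) <= saturation P S}.
Proof.
move=> x /saturationP[s Ps /saturationP[t Pt Sx]]; apply/saturationP.
exists (t * s); first exact: prime_notinM.
by rewrite -scalerA.
Qed.

(** Finitely many denominators have a common multiple. *)
Lemma saturation_common P S n (F : 'I_n -> M) : submod_closed S ->
    (forall i, F i \in saturation P S) ->
  exists2 s : R, s \notin (P : {pred R}) & forall i, s *: F i \in S.
Proof.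
move=> cS satF.
have /choice[s sP] i : exists s : R, s \notin (P : {pred R}) /\ s *: F i \in S.
  by have /saturationP[s] := satF i; exists s.
exists (\prod_i s i) => [|i].
  elim/big_ind: _ => [|x y|i _]; [by rewrite idealr1 | | exact: (sP i).1].
  exact: prime_notinM.
by rewrite (bigD1 i) //= mulrC -scalerA; apply: submodZ => //; exact: (sP i).2.
Qed.

(** The ideal of the a with a x in S contains C; were it proper, it would lie
    in a prime P above C, and x could not be in the saturation of S at P. *)
Lemma local_global C S x :
    submod_closed S -> (forall a, a \in C -> a *: x \in S) ->
    (forall P, {subset C <= (P : {pred R})} -> x \in saturation P S) ->
  x \in S.
Proof.
move=> cS CS satx.
pose J : {pred R^o} := fun a : R => a *: x \in S.
have JE (a : R) : (a \in J) = (a *: x \in S) by [].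
have cJ : submod_closed J.
  split=> [|a u v]; rewrite !JE ?scale0r ?submod0 // => Ju Jv.
  by rewrite scalerDl -scalerA; apply: submodD => //; exact: submodZ.
have [J1|/(exists_prime_above cJ)[P JP]] := boolP ((1 : R) \in J).
  by move: J1; rewrite JE scale1r.
have [a /CS aS|s Ps Sx] := saturationP _ _ _ (satx P _); first exact: JP.
by rewrite JP in Ps.
Qed.

(** By [local_global], a submodule above B is determined by its saturations at
    the primes above C. *)
Lemma finite_submods_local C B :
    (forall a x, a \in C -> a *: x \in B) ->
    finite_set (primes_above C) ->
    (forall P, {subset C <= (P : {pred R})} ->
      finite_set
        [set (saturation P S : M -> bool) | S in submods_above B]%classic) ->
  finite_set (submods_above B).
Proof.
move=> CB /primes_above_enum[n [P [_ PE]]] finP.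
pose F i (S : M -> bool) : M -> bool := saturation (P i) S.
apply: (@finite_set_family _ _ _ (submods_above B) F) => [i|S S'].
  by apply: finP; apply/PE; exists i.
move=> [cS BS] [cS' BS'] eqS.
have sub (X Y : M -> bool) : submod_closed Y -> {subset B <= (Y : {pred M})} ->
    (forall i, saturation (P i) X = saturation (P i) Y) -> forall x, X x -> Y x.
  move=> cY BY eqXY x Xx; apply: (@local_global C Y) => [|a Ca|Q CQ] //.
    by apply: BY; exact: CB.
  by have [i <-] := (PE Q).1 CQ; rewrite -eqXY; exact: sub_saturation.
apply/funext => x; apply/idP/idP; apply: sub => // i.
exact/esym/eqS.
Qed.

(** The denominator t is a unit of the localized ring, so it does not affect
    generation. *)
Lemma cyclic_generator_locP P (z : M) t :
  cyclic_generator (locfrac z t : localization P M) <->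
  forall y, y \in saturation P (cyclic_submod z).
Proof.
split=> [gen y|gen q].
  have [r] := gen (locfrac y (denom1 P)); have [a [u ->]] := ringfrac_surj r.
  rewrite locfracZ => /locfracP[v]; rewrite denom1E scale1r => vy.
  apply/saturationP; exists (dval v * dval (denomM u t)).
    by rewrite prime_notinM //; [exact: (valP v) | exact: (valP (denomM u t))].
  rewrite -scalerA vy; apply/cyclic_submodP.
  by exists (dval v * a); rewrite scalerA.
have [y [w ->]] := locfrac_surj q.
have /saturationP[s Ps /cyclic_submodP[a sy]] := gen y.
exists (ringfrac (a * dval t) (denomM (mkdenom Ps) w)).
rewrite locfracZ; apply/locfracP; exists (denom1 P).
rewrite !denomME denom1E !scale1r.
have -> : dval (mkdenom Ps) = s by [].
rewrite -!scalerA.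
have -> : s *: (dval w *: (dval t *: y)) = (dval w * dval t) *: (s *: y).
  by rewrite !scalerA; congr (_ *: _); ring.
by rewrite sy !scalerA; congr (_ *: _); ring.
Qed.

Lemma cyclic_locP P : cyclic_module (localization P M) <->
  exists z, forall y : M, y \in saturation P (cyclic_submod z).
Proof.
split=> [[q]|[z gen]].
  by have [z [t ->]] := locfrac_surj q; rewrite cyclic_generator_locP; exists z.
by exists (locfrac z (denom1 P)); apply/cyclic_generator_locP.
Qed.

(** * Primes with finite residue field *)

(** Let N be a saturated submodule above B that is maximal with M/N infinite,
    and N' minimal among the submodules strictly above N. For a in N' outside
    N, P a lies in N: if p a does not, then N + R p a = N' contains a, so that
    (1 - r p) a is in N for some r, and a is in N as N is saturated. The
    saturation Q of N + R a is strictly larger than N, so M/Q is finite by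
    maximality of N; and Q = N + R a because the elements outside P are
    invertible modulo P, so Q/N is a quotient of the finite field R/P. Hence
    M/N is finite, a contradiction. *)
Lemma finite_index_saturation P B :
    submod_closed B -> finite_set (submods_above B) ->
  finite_index (P : {pred R^o}) -> finite_index (saturation P B).
Proof.
move=> cB finB finP; apply: contrapT => ninf.
pose bad : set (M -> bool) := [set N : M -> bool |
  [/\ submods_above B N, {subset saturation P N <= (N : {pred M})} &
      ~ finite_index N]]%classic.
have sub_trans (X Y Z : M -> bool) : subpred X Y -> subpred Y Z -> subpred X Z.
  by move=> XY YZ x /XY/YZ.
have [||N [[cN BN] satN ninfN] Nmax] :=
  @finite_set_maximal _ (fun X Y : M -> bool => subpred X Y)
    bad (fun _ _ => id) sub_trans.
- by apply: sub_finite_set finB => N [].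
- exists (saturation P B); split=> //; last exact: saturation_idem.
  by split; [exact: saturation_closed | exact: sub_saturation].
pose above : set (M -> bool) := [set N' : M -> bool |
  [/\ submods_above B N', {subset N <= (N' : {pred M})} &
      exists2 x, x \in (N' : {pred M}) & x \notin (N : {pred M})]]%classic.
have [x0 Nx0] : exists x, x \notin (N : {pred M}).
  apply: contrapT => allN; apply: ninfN; exists unit, (fun=> tt) => x y _.
  by apply: contrapT => Nxy; apply: allN; exists (x - y); apply/negP.
have [|||N' [[cN' BN'] NN' [a N'a Na]] N'min] :=
  @finite_set_maximal _ (fun X Y : M -> bool => subpred Y X)
    above (fun _ _ => id).
- by move=> X Y Z XY YZ; exact: sub_trans YZ XY.
- by apply: sub_finite_set finB => X [].
- exists predT; split=> //; last by exists x0.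
have aboveI x : x \notin (N : {pred M}) -> above (submod_add N x).
  move=> Nx; split; last by exists x; rewrite ?mem_submod_add.
    split; first exact: submod_add_closed.
    by move=> y /BN; exact: sub_submod_add.
  exact: sub_submod_add.
have Pa p : p \in (P : {pred R}) -> p *: a \in (N : {pred M}).
  move=> Pp; apply: contrapT => /negP Npa.
  have sub : {subset submod_add N (p *: a) <= (N' : {pred M})}.
    move=> y /submod_addP[r Ny]; rewrite -(subrK (r *: (p *: a)) y).
    by apply: submodD (NN' _ Ny) _; rewrite // !(submodZ _ cN').
  have /submod_addP[r] := N'min _ (aboveI _ Npa) sub _ N'a.
  rewrite scalerA -{1}[a]scale1r -scalerBl => Nra; move/negP: Na; apply.
  apply: satN; apply/saturationP; exists (1 - r * p) => //.
  apply/negP => Prp; have : 1 \in (P : {pred R}).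
    by rewrite -(subrK (r * p) 1) rpredD ?idealMr.
  by rewrite idealr1.
have [aNA NA _] := aboveI _ Na; pose Q := saturation P (submod_add N a).
have cQ : submod_closed Q by apply: saturation_closed; exact: submod_add_closed.
have finQ : finite_index Q.
  apply: contrapT => ninfQ.
  have : bad Q.
    split=> //; last exact: saturation_idem.
    by split=> // x /BN/NA; exact: sub_saturation.
  move=> /Nmax QN; move/negP: Na; apply; apply: QN.
    by move=> x /NA; exact: sub_saturation.
  by apply: sub_saturation; exact: mem_submod_add.
have /choice[c cP] b : exists r : R, b \in Q -> b - r *: a \in (N : {pred M}).
  have [/saturationP[s Ps /submod_addP[r Nbr]]|_] := boolP (b \in Q);
    last by exists 0.
  have [t Pts] := finite_residue_inv finP Ps.
  have NPb p : p \in (P : {pred R}) -> p *: b \in (N : {pred M}).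
    move=> Pp; apply: satN; apply/saturationP; exists s => //.
    have -> : s *: (p *: b) = p *: (s *: b - r *: a) + r *: (p *: a).
      rewrite scalerBr !scalerA [p * r]mulrC subrK; congr (_ *: _); ring.
    by apply: submodD; rewrite // (submodZ _ cN) ?Pa.
  exists (t * r) => _.
  have -> : b - (t * r) *: a = t *: (s *: b - r *: a) - (t * s - 1) *: b.
    by rewrite scalerBr scalerBl !scalerA scale1r opprB [RHS]addrC addrA subrK.
  by apply: submodB; rewrite ?NPb // (submodZ _ cN).
have [T [l lP]] := finP; apply: ninfN.
apply: (@finite_index_trans _ _ _ Q T (fun b => l (c b))) => //.
move=> x y Qx Qy /lP Pc.
have -> : x - y = (x - c x *: a) - (y - c y *: a) + (c x - c y) *: a.
  by rewrite scalerBl opprB addrACA subrK [c y *: a - y]addrC addrK.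
exact: submodD cN (submodB cN (cP x Qx) (cP y Qy)) (Pa _ Pc).
Qed.

End Saturation.

Section Annihilator.
Variables (R : comNzRingType) (M : lmodType R).
Implicit Types (P : prime_idealr R).

Let C : {pred R^o} := annihilator M.

Lemma annihilator_closed : submod_closed (annihilator M : {pred R^o}).
Proof.
split=> [|a u v Cu Cv]; first exact: rpred0.
by apply: rpredD => //; exact: annihilatorMl.
Qed.

(** Let K be the saturation of 0 and D that of C, and let e generate M. As D M
    is contained in K, the coefficients of x modulo D determine x modulo K;
    conversely, a is determined modulo D by the classes of the a e_i modulo K,
    because finitely many denominators have a common multiple. *)
Lemma finite_index_annihilator P n (e : 'I_n -> M) : generates e ->
  finite_index (saturation P C) <->
  finite_index (saturation P (@zero_submod R M)).
Proof.
move=> gen; split=> [[T [l lP]]|[T [l lP]]].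
  have /choice[c cP] (x : M) : exists c : 'I_n -> R, x = \sum_i c i *: e i.
    exact: gen.
  exists {ffun 'I_n -> T}, (fun x => [ffun i => l (c x i)]) => x y eql.
  rewrite [x]cP [y]cP -sumrB; apply: submod_sum => [|i].
    exact/saturation_closed/zero_submod_closed.
  have /lP/saturationP[s Ps sC] : l (c x i) = l (c y i).
    by move/ffunP/(_ i): eql; rewrite !ffunE.
  apply/saturationP; exists s => //; rewrite -scalerBl scalerA.
  by apply/eqP; exact: (annihilatorP M _ sC).
exists {ffun 'I_n -> T}, (fun a : R => [ffun i => l (a *: e i)]) => a b eql.
have [i|s Ps se] := @saturation_common _ _ P (@zero_submod R M) n
    (fun i => (a - b) *: e i) (zero_submod_closed _).
  by rewrite scalerBl; apply: lP; move/ffunP/(_ i): eql; rewrite !ffunE.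
apply/saturationP; exists s => //; apply/annihilatorP => x.
have [c ->] := gen x; rewrite scaler_sumr big1 // => i _.
have -> : (s * (a - b)) *: (c i *: e i) = c i *: (s *: ((a - b) *: e i)).
  by rewrite !scalerA; congr (_ *: _); ring.
by rewrite (eqP (se i)) scaler0.
Qed.

(** * Ideals of the quotient by the annihilator *)

Lemma ann_proj0 : ann_proj M 0 = 0.
Proof. by apply: (addrI (ann_proj M 0)); rewrite -ann_projD !addr0. Qed.

(** Direct and inverse images under the projection are mutually inverse. *)
Lemma finite_ideals_ann_quot : finitely_many_ideals (ann_quot M) <->
  finite_set (submods_above (annihilator M : {pred R^o})).
Proof.
split=> /finite_labelP[T [l linj]]; apply/finite_labelP.
  pose img (I : R -> bool) : ann_quot M -> bool :=
    fun q => `[< exists2 a, a \in (I : {pred R}) & q = ann_proj M a >].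
  have imgE (I : R -> bool) a : submods_above (annihilator M : {pred R^o}) I ->
      (ann_proj M a \in (img I : {pred (ann_quot M)^o})) =
      (a \in (I : {pred R})).
    move=> [cI CI]; apply/asboolP/idP => [[b Ib /ann_projP/CI Iab]|Ia];
      last by exists a.
    by rewrite -(subrK b a); exact: (submodD cI).
  exists T, (fun I => l (img I)) => I J hI hJ /linj eqIJ.
  have img_closed K : submods_above (annihilator M : {pred R^o}) K ->
      submod_closed (img K : {pred (ann_quot M)^o}).
    move=> hK; have [cK _] := hK.
    split=> [|a u v].
      by rewrite -ann_proj0 imgE //; exact: (submod0 cK).
    have [a' ->] := ann_proj_surj a; have [u' ->] := ann_proj_surj u.
    have [v' ->] := ann_proj_surj v.
    rewrite !imgE // -[_ *: _]/(ann_mul _ _) -ann_projM -ann_projD imgE //.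
    by case: cK => _; apply.
  apply/funext => a; have := imgE I a hI; have := imgE J a hJ.
  by rewrite (eqIJ (img_closed _ hI) (img_closed _ hJ)) => ->.
exists T, (fun J => l (fun a => J (ann_proj M a))) => I J cI cJ /linj eqIJ.
have pre_closed (K : (ann_quot M)^o -> bool) : submod_closed K ->
    submods_above (annihilator M : {pred R^o}) (fun a => K (ann_proj M a)).
  move=> [K0 Klin]; split=> [|a Ca]; last first.
    rewrite unfold_in; have -> : ann_proj M a = 0; last exact: K0.
    by rewrite -ann_proj0; apply: (ann_projP M a 0).2; rewrite subr0.
  split=> [|a u v Ku Kv]; first by rewrite unfold_in ann_proj0.
  by rewrite unfold_in ann_projD ann_projM; exact: Klin.
apply/funext => q; have [a ->] := ann_proj_surj q.
exact: (congr1 (fun f => f a) (eqIJ (pre_closed _ cI) (pre_closed _ cJ))).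
Qed.

(** * From finitely many ideals to finitely many submodules *)

Lemma finite_primes_of_ideals :
  finite_set (submods_above C) -> finite_set (primes_above C).
Proof.
apply: sub_finite_set => p [P CP ->]; split=> //; exact: prime_submod_closed.
Qed.

(** If z generates M at P, the saturation of a submodule N is that of J z,
    where J, the ideal of the a with a z in the saturation of N, contains C. *)
Lemma finite_submods_of_ideals n (e : 'I_n -> M) : generates e ->
    finite_set (submods_above C) ->
    (forall P, {subset C <= (P : {pred R})} -> infinite_type {ideal_quot P} ->
      exists z, forall y : M, y \in saturation P (cyclic_submod z)) ->
  finite_set (submods_above (@zero_submod R M)).
Proof.
move=> gen finC locC; apply: (@finite_submods_local _ _ C).
- by move=> a x Ca; apply/eqP; exact: (annihilatorP M a Ca).
- exact: finite_primes_of_ideals.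
move=> P CP.
have [infP|/finite_residueP finP] := pselect (infinite_type {ideal_quot P}).
  have [z zP] := locC P CP infP.
  pose g (J : R -> bool) : M -> bool := saturation P (scale_ideal J z).
  apply: sub_finite_set (finite_image g finC) => _ [N [cN _] <-].
  have cP := saturation_closed P cN.
  pose J : R -> bool := fun a => a *: z \in saturation P N.
  have JE a : (a \in (J : {pred R^o})) = (a *: z \in saturation P N) by [].
  exists J; first split=> [|a Ca].
  - split=> [|a u v]; rewrite !JE ?scale0r ?submod0 // => Ju Jv.
    by rewrite scalerDl -scalerA; apply: submodD => //; exact: submodZ.
  - by rewrite JE (annihilatorP M a Ca) submod0.
  apply/funext => y; apply/idP/idP.
    move=> /saturationP[s Ps /scale_idealP[a Ja sy]].
    by apply: saturation_idem; apply/saturationP; exists s; rewrite // sy.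
  move=> Ny; have /saturationP[s Ps /cyclic_submodP[a sy]] := zP y.
  apply/saturationP; exists s => //; apply/scale_idealP; exists a => //.
  by rewrite JE -sy; exact: submodZ.
have finI : finite_index (saturation P (@zero_submod R M)).
  apply/(finite_index_annihilator P gen); apply: finite_index_saturation => //.
  exact: annihilator_closed.
apply: sub_finite_set (finite_submods_above_index finI) => _ [N [cN N0] <-].
by split; [exact: saturation_closed | exact: saturationS].
Qed.

(** * From finitely many submodules to finitely many ideals *)

Hypothesis finM : finitely_many_submodules M.

Lemma finite_submods_above B : finite_set (submods_above (M := M) B).
Proof. by apply: sub_finite_set finM => S []. Qed.

(** M is the union of its cyclic submodules, which are finite in number. *)
Lemma finitely_generated_of_finite : finitely_generated M.
Proof.
pose cyc : set (M -> bool) :=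
  [set S | exists x : M, S = cyclic_submod x :> (M -> bool)]%classic.
have /finite_set_enum[n [f [_ fE]]] : finite_set cyc.
  by apply: sub_finite_set finM => _ [x ->]; exact: cyclic_submod_closed.
have /choice[e eP] i : exists x : M, f i = cyclic_submod x :> (M -> bool).
  by apply/fE; exists i.
exists n, e => x.
have [i fi] := (fE (cyclic_submod x : M -> bool)).1 (ex_intro _ x erefl).
have /cyclic_submodP[a xa] : x \in cyclic_submod (e i).
  have eqcyc : cyclic_submod (e i) = cyclic_submod x :> (M -> bool).
    by rewrite -eP.
  by rewrite eqcyc mem_cyclic.
exists (fun j => if j == i then a else 0).
rewrite (bigD1 i) //= eqxx big1 ?addr0 // => j /negPf ->; exact: scale0r.
Qed.

(** Choose z such that the saturation of R z is maximal. For any y, two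
    elements z + a y and z + b y with a - b outside P generate the same
    submodule R w, which then contains (a - b) y and (a - b) z; so z and y lie
    in the saturation of R w, which equals that of R z by maximality. *)
Lemma locally_cyclic_of_finite P : infinite_type {ideal_quot P} ->
  exists z, forall y : M, y \in saturation P (cyclic_submod z).
Proof.
move=> infP.
pose cyc : set (M -> bool) :=
  [set S | exists x : M,
     S = saturation P (cyclic_submod x) :> (M -> bool)]%classic.
have [|||_ [z ->] zmax] :=
  @finite_set_maximal _ (fun X Y : M -> bool => subpred X Y)
    cyc (fun _ _ => id).
- by move=> X Y Z XY YZ x /XY/YZ.
- apply: sub_finite_set finM => _ [x ->].
  exact/saturation_closed/cyclic_submod_closed.
- by exists (saturation P (cyclic_submod (0 : M))); exists 0.
exists z => y.
have [a [b [Pab eqab]]] : exists a b : R, a - b \notin (P : {pred R}) /\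
    cyclic_submod (z + a *: y) = cyclic_submod (z + b *: y) :> (M -> bool).
  apply: contrapT => nab.
  have /finite_labelP[T [l linj]] := finM.
  suff /finite_residueP : finite_index (P : {pred R^o}) by apply.
  exists T, (fun a : R => l (cyclic_submod (z + a *: y))) => a b eql.
  apply: contrapT => /negP Pab; apply: nab; exists a, b; split=> //.
  by apply: linj => //; exact: cyclic_submod_closed.
pose w := z + a *: y; have cw := cyclic_submod_closed w.
have w1 : z + a *: y \in cyclic_submod w by exact: mem_cyclic.
have w2 : z + b *: y \in cyclic_submod w by rewrite eqab mem_cyclic.
have wy : y \in saturation P (cyclic_submod w).
  apply/saturationP; exists (a - b) => //.
  have -> : (a - b) *: y = (z + a *: y) - (z + b *: y).
    by rewrite opprD addrACA subrr add0r scalerBl.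
  exact: submodB.
have wz : z \in saturation P (cyclic_submod w).
  apply/saturationP; exists (a - b) => //.
  have -> : (a - b) *: z = a *: (z + b *: y) - b *: (z + a *: y).
    rewrite !scalerDr !scalerA [b * a]mulrC opprD addrACA subrr addr0.
    by rewrite scalerBl.
  by apply: submodB; rewrite ?submodZ.
apply: (zmax (saturation P (cyclic_submod w))) => //; first by exists w.
move=> x zx; apply: saturation_idem; apply: saturationS zx.
by apply: cyclic_sub => //; exact: saturation_closed.
Qed.

(** A prime Q above C contains the annihilator of some e_i, since otherwise a
    common denominator outside Q would kill M. For this i, Q consists of the a
    with a e_i in Q e_i. *)
Lemma finite_primes_of_finite n (e : 'I_n -> M) : generates e ->
  finite_set (primes_above C).
Proof.
move=> gen; pose F i (p : R -> bool) : M -> bool := scale_ideal p (e i).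
apply: (@finite_set_family _ _ _ _ F) => [i|p p'].
  apply: sub_finite_set finM => _ [p [P _ ->] <-].
  exact/scale_ideal_closed/prime_submod_closed.
have sub (P Q : prime_idealr R) : {subset C <= (Q : {pred R})} ->
    (forall i, F i P = F i Q) -> forall a, P a -> Q a.
  move=> CQ eqF a Pa.
  have [i annQ] : exists i, forall s : R, s *: e i = 0 -> s \in (Q : {pred R}).
    apply: contrapT => nQ.
    have [i|s Qs se] :=
      @saturation_common _ _ Q (@zero_submod R M) n e (zero_submod_closed _).
      apply: contrapT => nsat; apply: nQ; exists i => s se.
      apply: contrapT => /negP Qs; apply: nsat; apply/saturationP.
      by exists s => //; exact/eqP.
    move/negP: Qs; apply; apply: CQ; apply/annihilatorP => x.
    have [c ->] := gen x; rewrite scaler_sumr big1 // => i _.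
    by rewrite scalerA mulrC -scalerA (eqP (se i)) scaler0.
  have /scale_idealP[b Qb ab] : a *: e i \in (F i Q : {pred M}).
    by rewrite -eqF; apply/scale_idealP; exists a.
  rewrite -[Q a]/(a \in (Q : {pred R})) -(subrK b a) rpredD //.
  by apply: annQ; rewrite scalerBl ab subrr.
move=> [P CP ->] [Q CQ ->] eqF.
apply/funext => a; apply/idP/idP; exact: sub.
Qed.

(** If z generates M at P, some t outside P satisfies t M <= R z, so the
    annihilator of z multiplied by t lies in C. Hence, for an ideal I
    containing C, the saturation of I consists of the a such that a z is in
    the saturation of I z. *)
Lemma finite_ideals_of_finite : finite_set (submods_above C).
Proof.
have [n [e gen]] := finitely_generated_of_finite.
apply: (@finite_submods_local _ _ C).
- by move=> a x Ca; rewrite -[_ *: _]/(a * x) mulrC; exact: annihilatorMl.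
- exact: finite_primes_of_finite gen.
move=> P CP.
have [infP|/finite_residueP finP] := pselect (infinite_type {ideal_quot P}).
  have [z zP] := locally_cyclic_of_finite infP.
  pose g (N : M -> bool) : R -> bool := fun a => a *: z \in saturation P N.
  apply: sub_finite_set (finite_image g finM) => _ [I [cI CI] <-].
  exists (scale_ideal I z); first exact: scale_ideal_closed.
  apply/funext => a; apply/idP/idP; last first.
    move=> /saturationP[s Ps Isa]; apply/saturationP; exists s => //.
    by apply/scale_idealP; exists (s * a); rewrite ?scalerA.
  move=> /saturationP[s Ps /scale_idealP[b Ib sab]].
  have [t Pt te] :=
    saturation_common (cyclic_submod_closed z) (fun i => zP (e i)).
  apply/saturationP; exists (t * s); first exact: prime_notinM.
  rewrite -[_ *: _]/(t * s * a).
  have -> : t * s * a = t * (s * a - b) + t * b by ring.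
  apply: (submodD cI); last exact: (submodZ t cI).
  apply: CI; apply/annihilatorP => x.
  have [c ->] := gen x; rewrite scaler_sumr big1 // => i _.
  have /cyclic_submodP[d tei] := te i.
  have -> : (t * (s * a - b)) *: (c i *: e i) =
            (c i * (s * a - b)) *: (t *: e i).
    by rewrite !scalerA; congr (_ *: _); ring.
  rewrite tei scalerA.
  have -> : c i * (s * a - b) * d = (c i * d) * (s * a - b) by ring.
  by rewrite -scalerA scalerBl -[(s * a) *: z]scalerA sab subrr scaler0.
have finI : finite_index (saturation P C).
  apply/(finite_index_annihilator P gen); apply: finite_index_saturation finP.
    exact: zero_submod_closed.
  exact: finite_submods_above.
apply: sub_finite_set (finite_submods_above_index finI) => _ [N [cN CN] <-].
by split; [exact: saturation_closed | exact: saturationS].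
Qed.

End Annihilator.

Theorem corollary5p6 (R : comNzRingType) (M : lmodType R) :
  let C := annihilator M in
  let cond1 :=
    finitely_generated M /\
    forall P : prime_idealr R, {subset C <= (P : {pred R})} ->
      infinite_type {ideal_quot P} ->
      cyclic_module (localization P M) in
  let cond2 := finitely_many_ideals (ann_quot M) in
  (finitely_many_submodules M <-> cond1 /\ cond2) /\
  (cond1 -> cond2 ->
    (exists n (P : 'I_n -> prime_idealr R), enumerates_primes_over C P) /\
    forall n (P : 'I_n -> prime_idealr R),
      enumerates_primes_over C P ->
      (forall i, infinite_type {ideal_quot P i}) ->
      exists e : 'I_n -> M,
        generates e /\
        forall i, cyclic_generator (loc_map (P i) (e i))).
Proof.
move=> C cond1 cond2; split; first split.
- move=> finM; split; last first.
    by apply/finite_ideals_ann_quot; exact: finite_ideals_of_finite.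
  split=> [|P _ infP]; first exact: finitely_generated_of_finite.
  by apply/cyclic_locP; exact: locally_cyclic_of_finite.
- move=> [[[n [e gen]] locC] /finite_ideals_ann_quot finC].
  have := finite_submods_of_ideals gen finC
    (fun P CP infP => (cyclic_locP M P).1 (locC P CP infP)).
  by apply: sub_finite_set => S cS; split=> // x /eqP->; exact: (submod0 cS).
move=> [_ locC] /finite_ideals_ann_quot finC; split.
  exact/primes_above_enum/finite_primes_of_ideals.
move=> n P [_ PE] infP.
have /choice[e eP] i :
    exists z, forall y : M, y \in saturation (P i) (cyclic_submod z).
  by apply/cyclic_locP/locC => //; apply/PE; exists i.
exists e; split=> [x|i]; last by apply/cyclic_generator_locP.
pose N : {pred M} :=
  fun x => `[< exists c : 'I_n -> R, x = \sum_(i < n) c i *: e i >].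
have cN : submod_closed N.
  split=> [|a u v /asboolP[c ->] /asboolP[d ->]]; apply/asboolP.
    by exists (fun=> 0); rewrite big1 // => i _; rewrite scale0r.
  exists (fun i => a * c i + d i); rewrite scaler_sumr -big_split /=.
  by apply: eq_bigr => i _; rewrite scalerDl scalerA.
suff /asboolP : x \in N by [].
apply: (local_global (C := C)) => // [a Ca|Q /PE[i <-]].
  by rewrite (annihilatorP M a Ca) submod0.
apply: saturationS (eP i x); apply: cyclic_sub => //; apply/asboolP.
exists (fun j => if j == i then 1 else 0).
rewrite (bigD1 i) //= eqxx scale1r big1 ?addr0 // => j /negPf ->.
exact: scale0r.
Qed.
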